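(* (i) The set of p*-variables is closed under convex combinations and under distribution mixtures. (ii) The set of p-variables is closed under distribution mixtures but not under convex combinations. (iii) The set of mid p-variables is neither closed under convex combinations nor under distribution mixtures. (iv) The three sets above (p*-variables, p-variables, mid p-variables) are all closed under convergence in distribution.
   Context: All random variables live on a fixed atomless probability space $(\Omega,\mathcal A,\mathbb P)$, assumed rich enough that for any given random vector there exists a random variable uniform on $[0,1]$ independent of it. ''Increasing'' is in the non-strict sense. For random variables $X,Y$: $X\le_1 Y$ (equivalently $Y\ge_1 X$) means $\mathbb E[f(X)]\le \mathbb E[f(Y)]$ for all increasing real functions $f$ such that the expectations exist; $X\le_2 Y$ means the same inequality for all increasing concave real functions $f$ such that the expectations exist. With $U$ uniform on $[0,1]$: $P$ is a p-variable if $U\le_1 P$ (equivalently $\mathbb P(P\le\alpha)\le\alpha$ for all $\alpha\in(0,1)$); $P$ is a p*-variable if $U\le_2 P$. $P$ is a mid p-variable if $P\ge_1 P_T$ for some real random variable $T$, where $P_T=\tfrac12 F(T-)+\tfrac12 F(T)$, $F$ is the distribution function of $T$, and $F(t-)=\lim_{s\uparrow t}F(s)$. A set $S$ of random variables is closed under convex combinations if $\sum_{k=1}^K\lambda_kP_k\in S$ for all $K$, all $P_1,\dots,P_K\in S$ (with arbitrary dependence) and all constants $\lambda_k\ge 0$ with $\sum_k\lambda_k=1$. It is closed under distribution mixtures if every random variable whose distribution is a mixture (i.e. $\int F_\theta\,\mu(\mathrm d\theta)$ for a probability measure $\mu$ and a measurable family $(F_\theta)$; finite mixtures being a special case) of distributions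 of elements of $S$ belongs to $S$. It is closed under convergence in distribution if every random variable that is the limit in distribution of a sequence of elements of $S$ belongs to $S$. *)

(* Defs.v *)
From HB Require Import structures.
From mathcomp Require Import all_boot all_order all_algebra.
From mathcomp Require Import all_classical all_reals all_analysis.

Set Implicit Arguments.
Unset Strict Implicit.
Unset Printing Implicit Defensive.

Import Order.TTheory GRing.Theory Num.Theory.
Import numFieldTopology.Exports numFieldNormedType.Exports.

Local Open Scope classical_set_scope.
Local Open Scope ring_scope.

Section Definitions.
Context {d : measure_display} {Omega : measurableType d} {R : realType}.
Variable P : probability Omega R.

Definition atomless : Prop :=
  forall A, measurable A -> (0 < P A)%E ->
    exists B, [/\ measurable B, B `<=` A & (0 < P B < P A)%E].

(* Laws are compared on measurable sets only: outside of them the value of a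
   [measure] is unconstrained. *)
Definition uniform01 (U : {RV P >-> R}) : Prop :=
  forall A, measurable A ->
    distribution P U A = uniform_prob (@ltr01 R) A.

Definition independent_RV d1 d2
    (T1 : measurableType d1) (T2 : measurableType d2)
    (X : {RV P >-> T1}) (Y : {RV P >-> T2}) : Prop :=
  forall A B, measurable A -> measurable B ->
    P (X @^-1` A `&` Y @^-1` B) = (P (X @^-1` A) * P (Y @^-1` B))%E.

Definition rich : Prop :=
  forall (n : nat) (X : {RV P >-> n.-tuple R}),
    exists2 U : {RV P >-> R}, uniform01 U & independent_RV U X.

(* The expectation exists when it is not of the form oo - oo; it may be
   infinite.  With finite expectations only, a variable whose negative part has
   infinite mean would be a p*-variable vacuously. *)
Definition expectation_exists (X : Omega -> R) : Prop :=
  ('E_P[X^\+] < +oo)%E \/ ('E_P[X^\-] < +oo)%E.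

Definition concave_function (f : R -> R) : Prop :=
  convex_function [set: R^o] (fun x => - f x).

Definition order1 (X Y : Omega -> R) : Prop :=
  forall f : R -> R, {homo f : x y / x <= y} ->
    expectation_exists (f \o X) -> expectation_exists (f \o Y) ->
    ('E_P[f \o X] <= 'E_P[f \o Y])%E.

Definition order2 (X Y : Omega -> R) : Prop :=
  forall f : R -> R, {homo f : x y / x <= y} -> concave_function f ->
    expectation_exists (f \o X) -> expectation_exists (f \o Y) ->
    ('E_P[f \o X] <= 'E_P[f \o Y])%E.

Definition p_variable : set {RV P >-> R} :=
  [set X | exists2 U : {RV P >-> R}, uniform01 U & order1 U X].

Definition pstar_variable : set {RV P >-> R} :=
  [set X | exists2 U : {RV P >-> R}, uniform01 U & order2 U X].

Definition df (X : {RV P >-> R}) (x : R) : R := fine (cdf X x).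

Definition df_left (X : {RV P >-> R}) (x : R) : R :=
  lim (df X s @[s --> x^'-]).

Definition mid_transform (T : {RV P >-> R}) (w : Omega) : R :=
  2^-1 * df_left T (T w) + 2^-1 * df T (T w).

Definition mid_p_variable : set {RV P >-> R} :=
  [set X | exists T : {RV P >-> R}, order1 (mid_transform T) X].

Definition closed_convex_combinations (S : set {RV P >-> R}) : Prop :=
  forall (K : nat) (lambda : 'I_K -> R) (X : 'I_K -> {mfun Omega >-> R}),
    (forall k, S (X k)) -> (forall k, 0 <= lambda k) ->
    \sum_(k < K) lambda k = 1 ->
    S (\sum_(k < K) lambda k *: X k).

(* The measurable family (F_theta) is a probability kernel to R. *)
Definition closed_distribution_mixtures (S : set {RV P >-> R}) : Prop :=
  forall (d' : measure_display) (Theta : measurableType d')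
    (mu : probability Theta R) (F : R.-pker Theta ~> R),
    (forall theta, exists2 Y, S Y &
       forall A, measurable A -> distribution P Y A = F theta A) ->
    forall X : {RV P >-> R},
      (forall A, measurable A ->
         distribution P X A = \int[mu]_theta F theta A)%E ->
      S X.

Definition cvg_in_distribution (X_ : nat -> {RV P >-> R}) (X : {RV P >-> R}) :
    Prop :=
  forall x : R, {for x, continuous (df X)} ->
    df (X_ n) x @[n --> \oo] --> df X x.

Definition closed_cvg_in_distribution (S : set {RV P >-> R}) : Prop :=
  forall (X_ : nat -> {RV P >-> R}) (X : {RV P >-> R}),
    (forall n, S (X_ n)) -> cvg_in_distribution X_ X -> S X.

End Definitions.

(* Main.v *)
From HB Require Import structures.
Require Import Defs.
From mathcomp Require Import all_boot all_order all_algebra.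
From mathcomp Require Import all_classical all_reals all_analysis.
From mathcomp Require Import measurable_realfun ring lra.

(** Each of the three classes is described by a condition that is visibly stable
    under the operations concerned.

    A p-variable is a variable whose distribution function lies below that of a
    uniform variable [U]. A p*-variable is a variable [X] such that
    [E k(X) <= E k(U)] for every nonnegative nonincreasing convex [k]: only
    integrals of nonnegative functions occur, so that Jensen, Fubini and Fatou
    apply directly.

    Mid p-values are obtained from a uniform variable by replacing it, on each
    member of some family of disjoint subintervals of the unit interval, by its
    midpoint, and [X] is a mid p-variable iff its quantile function
    dominates the midpoint map of such a family. Writing [l u] and [r u] for the
    ends of the interval containing [u], a sequence of families has a pointwise
    limit along an ultrafilter, and the limit is again such a family; this gives
    closedness in distribution without a selection theorem. *)

Set Implicit Arguments.
Unset Strict Implicit.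
Unset Printing Implicit Defensive.

Import Order.TTheory GRing.Theory Num.Theory.
Import numFieldTopology.Exports numFieldNormedType.Exports.

Local Open Scope classical_set_scope.
Local Open Scope ring_scope.

(** * Continuity points of distribution functions *)

Section DistributionFunction.
Context {d : measure_display} {Omega : measurableType d} {R : realType}.
Variable P : probability Omega R.
Implicit Types X Y T U : {RV P >-> R}.

Lemma cdf_df X x : cdf X x = (df X x)%:E.
Proof. by rewrite /df fineK// fin_num_measure. Qed.

Lemma df_ge0 X x : 0 <= df X x.
Proof. by rewrite -lee_fin -cdf_df. Qed.

Lemma df_le1 X x : df X x <= 1.
Proof. by rewrite -lee_fin -cdf_df cdf_le1. Qed.

Lemma df_nondecreasing X : nondecreasing_fun (df X).
Proof. by move=> x y xy; rewrite -lee_fin -!cdf_df cdf_nondecreasing. Qed.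

Lemma df_right_continuous X : right_continuous (df X).
Proof.
move=> x; have := @cdf_right_continuous _ _ _ P X x.
rewrite cdf_df => /fine_cvgP[_]; exact.
Qed.

(** A monotone function has countably many discontinuities, a Lebesgue null set, whereas []a, b[]
    has positive measure. Convergence in distribution is tested only at continuity points, so the
    limit arguments below start from one. *)
Lemma df_continuity_dense X (a b : R) : a < b ->
  exists2 x, a < x < b & {for x, continuous (df X)}.
Proof.
move=> ab; apply: contrapT => nocont.
have : countable [set x | x \in (`]a, b[) /\ discontinuity (df X) x].
  by apply: discontinuity_countable => x y _ _; exact: df_nondecreasing.
have -> : [set x | x \in (`]a, b[) /\ discontinuity (df X) x] = `]a, b[%classic.
  apply/seteqP; split=> [x []//|x xab]; split => //.
  have cl : cvg (df X s @[s --> x^'-]).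
    apply: (@nondecreasing_at_left_is_cvgr _ (df X) x).
      by near=> z; move=> u v _ _; exact: df_nondecreasing.
    by near=> z; exists 1 => _ [u _ <-]; exact: df_le1.
  have cr : df X s @[s --> x^'+] --> df X x by exact: df_right_continuous.
  split=> //; first by apply/cvg_ex; exists (df X x).
  apply/eqP => lr; apply: nocont; exists x; first by move: xab; rewrite /= in_itv.
  apply/left_right_continuousP; split => //.
  by rewrite -(cvg_lim _ cr)// -lr.
move/countable_lebesgue_measure0.
rewrite lebesgue_measure_itv/= lte_fin ab => /eqP.
by rewrite -EFinB eqe subr_eq0 gt_eqF.
Unshelve. all: by end_near. Qed.

End DistributionFunction.

(** * The first stochastic order in terms of distribution functions *)

Section Order1.
Context {d : measure_display} {Omega : measurableType d} {R : realType}.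
Variable P : probability Omega R.
Implicit Types X Y T U : {RV P >-> R}.

Definition rv (f : Omega -> R) (mf : measurable_fun [set: Omega] f) :
  {RV P >-> R} := mfun_Sub (mem_set mf).

Lemma measurable_downset (D : set R) :
  (forall x y, x <= y -> D y -> D x) -> measurable D.
Proof.
move=> downD; apply: is_interval_measurable.
by move=> x y _ Dy z /andP[_ zy]; exact: downD Dy.
Qed.

Lemma preimage_measure_le X Y (A B : set R) : measurable A -> measurable B ->
  X @^-1` A `<=` Y @^-1` B -> (P (X @^-1` A) <= P (Y @^-1` B))%E.
Proof.
by move=> mA mB AB; apply: le_measure; rewrite ?inE//; exact: measurable_funPTI.
Qed.

(** A nonempty down-set, open or closed on the right or the whole line, is an increasing union of
    half-lines []-oo, u n]] with [u n] in it; continuity from below concludes. It is applied to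
    level sets of monotone functions without determining their shape. *)
Lemma measure_downset_le (X : {RV P >-> R}) (D : set R) (c : \bar R) :
  (forall x y, x <= y -> D y -> D x) -> (0 <= c)%E ->
  (forall x, D x -> (cdf X x <= c)%E) -> (P (X @^-1` D) <= c)%E.
Proof.
move=> downD c0 cD; have mD := measurable_downset downD.
have main (u : nat -> R) : nondecreasing_seq u -> (forall n, D (u n)) ->
    (forall x, D x -> exists n, x <= u n) -> (P (X @^-1` D) <= c)%E.
  move=> ndu Du cofu.
  have DE : X @^-1` D = \bigcup_n (X @^-1` `]-oo, u n]).
    apply/seteqP; split=> [w /cofu[n Xn]|w [n _]]; first by exists n; rewrite //= in_itv.
    by rewrite /= in_itv/= => Xu; exact: downD Xu (Du n).
  have cvu : P \o (fun n => X @^-1` `]-oo, u n]) @ \oo --> P (X @^-1` D).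
    have mX (A : set R) : measurable A -> measurable (X @^-1` A).
      by move=> mA; rewrite -[_ @^-1` _]setTI; exact: measurable_funPT.
    rewrite DE; apply: nondecreasing_cvg_mu => //.
    - by move=> n; exact: mX.
    - by rewrite -DE; exact: mX.
    - move=> m n mn; apply/subsetPset => w; rewrite /= !in_itv/= => /le_trans; apply.
      exact: ndu.
  rewrite -(cvg_lim _ cvu)//; apply: lime_le.
    by apply/cvg_ex; exists (P (X @^-1` D)).
  by near=> n; exact: cD.
have [->|/set0P[x0 Dx0]] := eqVneq D set0; first by rewrite preimage_set0 measure0.
have [ubD|nubD] := pselect (has_ubound D); last first.
  have Dall x : D x.
    apply: contrapT => nDx; apply: nubD; exists x => y Dy.
    by rewrite leNgt; apply/negP => /ltW/downD/(_ Dy).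
  apply: (main (fun n => n%:R)) => //; first by move=> m n; rewrite ler_nat.
  move=> x _; exists (Num.bound `|x|); rewrite (le_trans (ler_norm x))//.
  by rewrite ltW// archi_boundP.
have supD : has_sup D by split => //; exists x0.
have [Ds|nDs] := pselect (D (sup D)).
  by apply: (main (fun=> sup D)) => // x Dx; exists 0%N; exact: ub_le_sup.
apply: (main (fun n => sup D - n.+1%:R^-1)).
- move=> m n mn; rewrite lerD2l lerN2 lef_pV2 ?posrE//.
  by rewrite ler_nat.
- move=> n; have [//|y Dy /ltW ly] := @sup_adherent _ D n.+1%:R^-1 _ supD.
  exact: downD ly Dy.
- move=> x Dx.
  have xs : 0 < sup D - x.
    rewrite subr_gt0 lt_neqAle ub_le_sup// andbT.
    by apply/eqP => xs; apply: nDs; rewrite -xs.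
  exists (Num.bound (sup D - x)^-1); rewrite lerBrDr -lerBrDl.
  rewrite invf_ple ?posrE// (le_trans (ltW (archi_boundP _)))//.
    by rewrite invr_ge0 ltW.
  by rewrite ler_nat.
Unshelve. all: by end_near. Qed.

Definition rv_comp (h : R -> R) (mh : measurable_fun [set: R] h) X :=
  rv (measurableT_comp mh (measurable_funPT X)).

Lemma layer_cake X (h : R -> R) (mh : measurable_fun [set: R] h) :
  (forall x, 0 <= h x) ->
  ('E_P[h \o X] =
   \int[lebesgue_measure]_(r in `[0%R, +oo[) ccdf (rv_comp mh X) r)%E.
Proof.
move=> h0; rewrite -(@ge0_expectation_ccdf _ _ _ P (rv_comp mh X))// => w.
exact: h0.
Qed.

(** The set [{h > r}] is a down-set, so the tails of [h \o Y] and [h \o X] compare at every [r], and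
    the layer-cake formula integrates the comparison. *)
Lemma ge0_nonincreasing_expectation_le X Y (h : R -> R) :
  (forall a, df Y a <= df X a) -> (forall x, 0 <= h x) ->
  nonincreasing_fun h -> ('E_P[h \o Y] <= 'E_P[h \o X])%E.
Proof.
move=> YX h0 nih.
have mh : measurable_fun [set: R] h by exact: nonincreasing_measurable.
rewrite !layer_cake//; apply: ge0_le_integral => //.
- by apply: measurable_funTS; exact: ccdf_measurable.
- by apply: measurable_funTS; exact: ccdf_measurable.
move=> r _; apply: (@measure_downset_le Y (h @^-1` `]r, +oo[)) => //.
  move=> x y xy; rewrite /= !in_itv/= !andbT => /lt_le_trans; apply; exact: nih.
move=> x rx; apply: (@le_trans _ _ (cdf X x)); first by rewrite !cdf_df lee_fin.
apply: (@preimage_measure_le X (rv_comp mh X)) => // w.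
move: rx; rewrite /= !in_itv/= !andbT => rx Xx.
by rewrite (lt_le_trans rx)// nih.
Qed.

Lemma ge0_nondecreasing_expectation_le X Y (h : R -> R) :
  (forall a, df Y a <= df X a) -> (forall x, 0 <= h x) ->
  nondecreasing_fun h -> ('E_P[h \o X] <= 'E_P[h \o Y])%E.
Proof.
move=> YX h0 ndh.
have mh : measurable_fun [set: R] h by exact: nondecreasing_measurable.
rewrite !layer_cake//; apply: ge0_le_integral => //.
- by apply: measurable_funTS; exact: ccdf_measurable.
- by apply: measurable_funTS; exact: ccdf_measurable.
move=> r _; rewrite !ccdf_1_cdf leeB//.
apply: (@measure_downset_le Y (h @^-1` `]-oo, r])) => //.
  by move=> x y xy; rewrite /= !in_itv/=; apply: le_trans; exact: ndh.
move=> x rx; apply: (@le_trans _ _ (cdf X x)); first by rewrite !cdf_df lee_fin.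
apply: (@preimage_measure_le X (rv_comp mh X)) => // w.
move: w rx => w; rewrite /= in_itv/= => rx; rewrite /= !in_itv/= => Xx.
by rewrite (le_trans _ rx)// ndh.
Qed.

Lemma expectation_exists_ge0 (f : Omega -> R) :
  (forall w, 0 <= f w) -> expectation_exists P f.
Proof.
move=> f0; right; suff -> : f^\- = cst 0 by rewrite expectation_cst ltry.
by apply/funext => w; rewrite /funrneg /=; apply/max_idPr; rewrite oppr_le0.
Qed.

Lemma expectation_exists_le0 (f : Omega -> R) :
  (forall w, f w <= 0) -> expectation_exists P f.
Proof.
move=> f0; left; suff -> : f^\+ = cst 0 by rewrite expectation_cst ltry.
by apply/funext => w; rewrite /funrpos /=; apply/max_idPr.
Qed.

(** One direction tests with the indicator of []a, +oo[]. For the other, [f] is split into a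
    nondecreasing positive part and a nonincreasing negative part, to which the two comparisons
    above apply. *)
Lemma order1P X Y : order1 P X Y <-> forall a, df Y a <= df X a.
Proof.
split=> [XY a|YX f ndf _ _].
  pose f (x : R) : R := (a < x)%R%:R.
  have fE (Z : {RV P >-> R}) : 'E_P[f \o Z]%E = ccdf Z a.
    transitivity (P (Z @^-1` `]a, +oo[)) => //.
    rewrite -expectation_indic; last exact: measurable_funPTI.
    congr expectation; apply/funext => w; rewrite /f /= !indicE; congr (nat_of_bool _)%:R.
    by apply/idP/idP; rewrite inE/= in_itv/= andbT.
  have ndf : {homo f : x y / x <= y}.
    move=> x y xy; rewrite /f ler_nat; case: (ltP a x) => // ax.
    by rewrite (lt_le_trans ax xy).
  have ex (Z : {RV P >-> R}) : expectation_exists P (f \o Z).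
    by apply: expectation_exists_ge0 => w; exact: ler0n.
  have := XY f ndf (ex X) (ex Y); rewrite !fE !ccdf_1_cdf.
  rewrite !cdf_df -!EFinB lee_fin; lra.
rewrite expectation.unlock [leLHS]integralE [leRHS]integralE.
pose fp x := Num.max (f x) 0; pose fm x := Num.max (- f x) 0.
have Ep (Z : {RV P >-> R}) :
    (\int[P]_w (fun w => ((f \o Z) w)%:E)^\+ w = 'E_P[fp \o Z])%E.
  by rewrite expectation.unlock; apply: eq_integral => w _; rewrite funeposE EFin_max.
have Em (Z : {RV P >-> R}) :
    (\int[P]_w (fun w => ((f \o Z) w)%:E)^\- w = 'E_P[fm \o Z])%E.
  by rewrite expectation.unlock; apply: eq_integral => w _; rewrite funenegE EFin_max.
rewrite !Ep !Em leeB//.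
  apply: ge0_nondecreasing_expectation_le => // [x|x y xy].
    by rewrite /fp le_max lexx orbT.
  by rewrite /fp ge_max !le_max lexx orbT ndf.
apply: ge0_nonincreasing_expectation_le => // [x|x y xy].
  by rewrite /fm le_max lexx orbT.
by rewrite /fm ge_max !le_max lexx orbT lerN2 ndf.
Qed.

End Order1.

(** * Uniform variables and p-variables *)

Section Uniform.
Context {d : measure_display} {Omega : measurableType d} {R : realType}.
Variable P : probability Omega R.
Implicit Types X Y T U : {RV P >-> R}.
Implicit Types x : R.

Lemma df_uniform U x : uniform01 U -> 0 <= x <= 1 -> df U x = x.
Proof.
move=> unifU /andP[x0 x1]; apply: EFin_inj; rewrite -cdf_df /cdf unifU//.
rewrite /uniform_prob integral_uniform_pdf.
have -> : `]-oo, x] `&` `[0, 1] = `[0, x]%classic :> set R.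
  apply/seteqP; split=> y /=; rewrite !in_itv/=; first by case=> -> /andP[->].
  by move=> /andP[-> yx]; rewrite yx (le_trans yx).
rewrite (eq_integral (cst 1)%E); last first.
  move=> y; rewrite inE/= in_itv/= => /andP[y0 yx].
  by rewrite /uniform_pdf y0 (le_trans yx)//= subr0 invr1.
rewrite integral_cst// mul1e.
have := @lebesgue_measure_itv R `[0, x]; rewrite /= lte_fin.
by case: ltgtP x0 => // [x0|<-] _; rewrite ?sube0.
Qed.

Lemma df_uniform_le0 U x : uniform01 U -> x <= 0 -> df U x = 0.
Proof.
move=> unifU x0; apply/le_anti; rewrite df_ge0 andbT.
by rewrite (le_trans (df_nondecreasing U x0))// df_uniform// lexx ler01.
Qed.

Lemma df_uniform_ge1 U x : uniform01 U -> 1 <= x -> df U x = 1.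
Proof.
move=> unifU x1; apply/le_anti; rewrite df_le1/=.
by rewrite (le_trans _ (df_nondecreasing U x1))// df_uniform// lexx ler01.
Qed.

Lemma df_uniformE U x : uniform01 U -> df U x = Num.max 0 (Num.min x 1).
Proof.
move=> unifU; have [x0|/ltW x0] := leP x 0.
  by rewrite df_uniform_le0//; apply/esym/max_idPl; rewrite ge_min x0.
have [x1|/ltW x1] := leP x 1; first by rewrite df_uniform ?x0 ?x1// max_r.
by rewrite df_uniform_ge1// max_r.
Qed.

Lemma df_uniform_lipschitz U x e : uniform01 U -> 0 <= e ->
  df U (x + e) <= df U x + e.
Proof.
move=> unifU e0; rewrite !df_uniformE// ge_max addr_ge0 ?le_max ?lexx//=.
rewrite addr_maxl addr_minl le_max le_min !ge_min lexx/=.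
by rewrite lerDl e0 !orbT.
Qed.

Lemma df_uniform_sym U x : uniform01 U -> df U (1 - x) = 1 - df U x.
Proof.
move=> unifU; have [x0|/ltW x0] := leP x 0.
  by rewrite df_uniform_ge1 ?df_uniform_le0 ?subr0//; lra.
have [x1|/ltW x1] := leP x 1; first by rewrite !df_uniform//; lra.
by rewrite df_uniform_le0 ?df_uniform_ge1 ?subrr//; lra.
Qed.

(** All uniform variables have the same distribution function, so the one in the definition can be
    exchanged for a fixed [U]. *)
Lemma p_variableP (U X : {RV P >-> R}) : uniform01 U ->
  p_variable X <-> forall a, df X a <= df U a.
Proof.
move=> unifU; split=> [[V unifV /order1P XV] a|XU]; last by exists U => //; apply/order1P.
by rewrite (le_trans (XV a))// !df_uniformE.
Qed.

Lemma rich_uniform : rich P -> exists U, uniform01 U.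
Proof. by move=> /(_ 0%N (cst [tuple]))[U unifU _]; exists U. Qed.

(** The distribution function of a mixture is the [mu]-average of those of the components. *)
Lemma p_variable_mixture : rich P ->
  closed_distribution_mixtures (@p_variable _ _ _ P).
Proof.
move=> /rich_uniform[U unifU] d' Theta mu F SF X XF.
apply/(p_variableP _ unifU) => a; rewrite -lee_fin -cdf_df /cdf XF//.
rewrite -(mule1 (df U a)%:E) -(@probability_setT _ _ _ mu) -integral_cst//.
apply: ge0_le_integral => //.
- exact: measurable_kernel.
- move=> t _; have [Y /(p_variableP _ unifU) YU <-//] := SF t.
  by rewrite -[distribution _ _ _]/(cdf Y a) cdf_df lee_fin.
Qed.

Lemma p_variable_cvg : rich P ->
  closed_cvg_in_distribution (@p_variable _ _ _ P).
Proof.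
move=> /rich_uniform[U unifU] X_ X pX_ cvgX.
apply/(p_variableP _ unifU) => a; apply/ler_addgt0Pr => e e0.
(* Moving from [a] to a continuity point just above it costs at most [e], by the Lipschitz bound on
   [df U]. *)
have [x /andP[ax xe] contx] := @df_continuity_dense _ _ _ P X a (a + e) ltac:(lra).
rewrite (le_trans (df_nondecreasing X (ltW ax)))//.
apply: (@le_trans _ _ (df U x)).
  rewrite -(cvg_lim _ (cvgX x contx))//; apply: limr_le.
    by apply/cvg_ex; exists (df X x); exact: cvgX.
  by near=> n; have /(p_variableP _ unifU) := pX_ n; exact.
have -> : x = a + (x - a) by rewrite addrC subrK.
rewrite (le_trans (df_uniform_lipschitz _ unifU _)) ?subr_ge0 ?(ltW ax)//.
by rewrite lerD2l lerBlDl ltW.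
Unshelve. all: by end_near. Qed.

(** The average of [U] and [1 - U] is the constant 1/2, whose distribution function at 1/2 is 1. *)
Lemma p_variable_not_convex : rich P ->
  ~ closed_convex_combinations (@p_variable _ _ _ P).
Proof.
move=> /rich_uniform[U unifU] closed.
have mV : measurable_fun [set: Omega] (fun w => 1 - U w).
  exact: measurable_funB.
pose V : {RV P >-> R} := rv P mV.
have pU : p_variable U by apply/(p_variableP _ unifU).
have pV : p_variable V.
  apply/(p_variableP _ unifU) => a; rewrite -lee_fin -!cdf_df.
  have -> : cdf V a = distribution P U `[1 - a, +oo[%classic.
    rewrite /cdf /distribution/= /pushforward; congr (P _).
    by apply/seteqP; split=> w; rewrite /= !in_itv/= andbT; lra.
  (* The closed half-line from [1 - a] is enlarged to the open one from [1 - a - e], whose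
     probability is a [ccdf]. *)
  apply/lee_addgt0Pr => e e0.
  apply: (@le_trans _ _ (ccdf U (1 - a - e))).
    apply: (preimage_measure_le (Y := U)) => // w.
    by rewrite /= !in_itv/= !andbT; lra.
  rewrite ccdf_1_cdf !cdf_df -EFinB -EFinD lee_fin -addrA -opprD df_uniform_sym//.
  by rewrite opprB addrC subrK df_uniform_lipschitz// ltW.
have pUV (i : 'I_2) : p_variable (if i == 0 then U else V) by case: ifP.
have h1 : \sum_(i < 2) 2^-1 = 1 :> R by rewrite big_ord_recl big_ord1; lra.
have h0 (i : 'I_2) : 0 <= 2^-1 :> R by rewrite invr_ge0 ler0n.
have /(p_variableP _ unifU) avgU := @closed 2%N (fun=> 2^-1) _ pUV h0 h1; clear h0.
have := avgU 2^-1; rewrite (df_uniform unifU); last by lra.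
apply/negP; rewrite -ltNge (@lt_le_trans _ _ 1)//; first by lra.
rewrite -lee_fin -cdf_df -(@probability_setT _ _ _ P) /cdf /distribution/= /pushforward.
rewrite (_ : _ @^-1` _ = setT)//; apply/seteqP; split=> // w _.
rewrite /= in_itv/= mfun_sum !big_ord_recl big_ord0 /= addr0.
by rewrite -[X in X <= _]/(2^-1 * U w + 2^-1 * (1 - U w)); lra.
Qed.

End Uniform.

(** * Finite Jensen inequality and superlevel sets of convex functions *)

Section ConvexFunctions.
Context {R : realType}.

Lemma convex_functionP (k : R -> R) : convex_function [set: R^o] k <->
  forall t x y, 0 <= t <= 1 -> k (t * x + (1 - t) * y) <= t * k x + (1 - t) * k y.
Proof.
split=> [ck t x y /andP[t0 t1]|ck t x y _ _]; last first.
  by apply: ck; rewrite ge0 le1.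
have := ck (Itv01 t0 t1) x y; rewrite !inE => /(_ I I).
exact.
Qed.

Lemma convex_sum_le (k : R -> R) (K : nat) (lambda x : 'I_K -> R) :
  convex_function [set: R^o] k -> (forall i, 0 <= lambda i) ->
  \sum_(i < K) lambda i = 1 ->
  k (\sum_(i < K) lambda i * x i) <= \sum_(i < K) lambda i * k (x i).
Proof.
move=> /convex_functionP ck; elim: K lambda x => [|K IH] lambda x lge0.
  by rewrite big_ord0 => /esym/eqP; rewrite oner_eq0.
rewrite !big_ord_recl; set t := lambda ord0 => sumE.
have t0 : 0 <= t by exact: lge0.
have sge0 : 0 <= \sum_(i < K) lambda (lift ord0 i) by apply: sumr_ge0.
(* The induction rescales the remaining weights by their sum, so a zero sum is treated apart. *)
have [s0|s0] := eqVneq (\sum_(i < K) lambda (lift ord0 i)) 0.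
  have l0 i : lambda (lift ord0 i) = 0.
    apply/eqP; move/eqP: s0; rewrite psumr_eq0// => /allP/(_ i).
    by rewrite mem_index_enum; exact.
  rewrite !big1 ?addr0; [|by move=> i _; rewrite l0 mul0r..].
  by rewrite s0 addr0 in sumE; rewrite sumE !mul1r.
set s := \sum_(i < K) _ in sumE s0 sge0.
have tE : 1 - t = s by rewrite -sumE addrC addKr.
have -> (f : R -> R) : \sum_(i < K) lambda (lift ord0 i) * f (x (lift ord0 i)) =
    (1 - t) * \sum_(i < K) (lambda (lift ord0 i) / s) * f (x (lift ord0 i)).
  by rewrite mulr_sumr; apply: eq_bigr => i _; rewrite tE; field.
have -> : \sum_(i < K) lambda (lift ord0 i) * x (lift ord0 i) =
    (1 - t) * \sum_(i < K) (lambda (lift ord0 i) / s) * x (lift ord0 i).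
  by rewrite mulr_sumr; apply: eq_bigr => i _; rewrite tE; field.
apply: le_trans (ck _ _ _ _) _; first by rewrite t0 -subr_ge0 tE.
rewrite lerD2l ler_wpM2l ?tE//; apply: IH => [i|]; first by rewrite divr_ge0.
by rewrite -mulr_suml divff.
Qed.

(** The chord through [x - 1] and [x], continued past [x], stays below [k], so [k] cannot drop to
    [t] at once. *)
Lemma convex_lt_right (k : R -> R) (t x : R) : convex_function [set: R^o] k ->
  nonincreasing_fun k -> t < k x -> exists2 y, x < y & t < k y.
Proof.
move=> /convex_functionP ck nik tx.
pose D := k (x - 1) - t; have D0 : 0 < D.
  by rewrite subr_gt0 (lt_le_trans tx)// nik// gerBl.
have DD0 : 0 < D + D by rewrite addr_gt0.
(* The point [y] below makes [x] the combination of [x - 1] and [y] with weights [s] and [1 - s].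
   Since [s * D] is only half of [k x - t], the inequality [t < k y] comes out strict. *)
pose s := (k x - t) / (D + D); have s0 : 0 < s by rewrite divr_gt0// subr_gt0.
have s1 : s <= 2^-1.
  have kD : k x - t <= D by rewrite lerD2r nik// gerBl.
  by rewrite /s ler_pdivrMr//; lra.
exists (x + s / (1 - s)); first by rewrite ltrDl divr_gt0//; lra.
have s1' : 1 - s != 0 by lra.
have := ck s (x - 1) (x + s / (1 - s)).
have -> : s * (x - 1) + (1 - s) * (x + s / (1 - s)) = x by field.
have sD : s * D = (k x - t) / 2 by rewrite /s; field; lra.
have -> : s <= 1 by lra.
rewrite (ltW s0) => /(_ isT) kx.
have : s * k (x - 1) = s * D + s * t by rewrite /D; ring.
move=> E; rewrite E sD in kx.
have s1lt : 0 < 1 - s by lra.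
rewrite -(ltr_pM2l s1lt); set ky := k (x + _) in kx *; nra.
Qed.

End ConvexFunctions.

(** * Test functions for p*-variables, and convex combinations *)

Section PstarVariables.
Context {d : measure_display} {Omega : measurableType d} {R : realType}.
Variable P : probability Omega R.
Implicit Types X Y T U : {RV P >-> R}.

Lemma expectation_mono (f g : Omega -> R) : measurable_fun [set: Omega] f ->
  measurable_fun [set: Omega] g -> (forall w, f w <= g w) ->
  ('E_P[f] <= 'E_P[g])%E.
Proof.
move=> /measurable_EFinP mf /measurable_EFinP mg fg.
rewrite expectation.unlock [leLHS]integralE [leRHS]integralE leeB//.
- apply: ge0_le_integral => //; [exact: measurable_funepos..|].
  by move=> w _; rewrite !funeposE le_max2// lee_fin.
- apply: ge0_le_integral => //; [exact: measurable_funeneg..|].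
  by move=> w _; rewrite !funenegE le_max2// -!EFinN lee_fin lerN2.
Qed.

Lemma expectation_ae_eq (f g : Omega -> R) : measurable_fun [set: Omega] f ->
  measurable_fun [set: Omega] g -> {ae P, forall w, f w = g w} ->
  'E_P[f]%E = 'E_P[g]%E.
Proof.
move=> /measurable_EFinP mf /measurable_EFinP mg fg.
rewrite expectation.unlock; apply: ae_eq_integral => //.
by apply: filterS fg => w /= -> _.
Qed.

Lemma expectation_cstB (c : R) (g : Omega -> R) :
  measurable_fun [set: Omega] g -> (forall w, 0 <= g w) ->
  ('E_P[g] < +oo)%E -> ('E_P[fun w => c - g w]%R = c%:E - 'E_P[g])%E.
Proof.
move=> mg g0 goo.
have g1 : g \in Lfun P 1.
  apply/Lfun1_integrable/integrableP; split; first exact/measurable_EFinP.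
  move: goo; rewrite expectation.unlock; congr (_ < _)%E.
  by apply: eq_integral => w _; rewrite /= ger0_norm.
by rewrite -(expectation_cst P c) -expectationB//; exact: Lfun_cst.
Qed.

Lemma uniform_ae U : uniform01 U -> {ae P, forall w, 0 <= U w <= 1}.
Proof.
move=> unifU; exists (U @^-1` `]-oo, 0] `|` U @^-1` `]1, +oo[); split.
- by apply: measurableU; exact: measurable_funPTI.
- have U1 : P (U @^-1` `]1, +oo[) = 0%E.
    by rewrite -[LHS]/(ccdf U 1) ccdf_1_cdf cdf_df df_uniform_ge1// subee.
  rewrite measureU0//; [|exact: measurable_funPTI..].
  by rewrite -[LHS]/(cdf U 0) cdf_df df_uniform_le0.
- move=> w /= /negP; rewrite !in_itv/= andbT negb_and -!ltNge.
  by move=> /orP[/ltW|]; [left|right].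
Qed.

Lemma pstar_variableP (U X : {RV P >-> R}) : uniform01 U ->
  pstar_variable X <-> forall k : R -> R, (forall x, 0 <= k x) ->
    nonincreasing_fun k -> convex_function [set: R^o] k ->
    ('E_P[k \o X] <= 'E_P[k \o U])%E.
Proof.
move=> unifU; split=> [[V unifV VX] k k0 nik ck|XU].
  have mk : measurable_fun [set: R] k by exact: nonincreasing_measurable.
  have NE (Z : {RV P >-> R}) : ('E_P[(\- k)%R \o Z] = - 'E_P[k \o Z])%E.
    rewrite expectation.unlock -integral_ge0N// => w _.
    by rewrite lee_fin k0.
  (* The function [- k] is nondecreasing, concave and nonpositive, so its expectations exist and it
     is an admissible test function. *)
  have := VX (\- k) _ _ _ _; rewrite !NE leeN2 => XV.
  apply: le_trans (XV _ _ _ _) _.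
  - by move=> x y xy; rewrite lerN2 nik.
  - rewrite /concave_function (_ : (fun x => _) = k)//.
    by apply/funext => x; rewrite /= opprK.
  - by apply: expectation_exists_le0 => w /=; rewrite oppr_le0.
  - by apply: expectation_exists_le0 => w /=; rewrite oppr_le0.
  (* [V] and [U] have the same distribution function. *)
  - apply: ge0_nonincreasing_expectation_le => // a.
    by rewrite !df_uniformE.
(* [k := (f 1 - f)^+] satisfies [f >= f 1 - k], with equality on
   the unit interval. *)
exists U => // f ndf cf _ _.
pose k x := Num.max (f 1 - f x) 0.
have k0 x : 0 <= k x by rewrite /k le_max lexx orbT.
have nik : nonincreasing_fun k.
  by move=> x y xy; rewrite /k ge_max !le_max lexx orbT lerD2l lerN2 ndf.
have mf : measurable_fun [set: R] f by exact: nondecreasing_measurable.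
have mk : measurable_fun [set: R] k by exact: nonincreasing_measurable.
have ck : convex_function [set: R^o] k.
  apply/convex_functionP => t x y /andP[t0 t1].
  move/convex_functionP : cf => /(_ t x y); rewrite t0 t1 => /(_ isT) cf.
  have s0 : 0 <= 1 - t by rewrite subr_ge0.
  have [kx ky] : f 1 - f x <= k x /\ f 1 - f y <= k y.
    by rewrite /k !le_max !lexx.
  rewrite {1}/k ge_max addr_ge0 ?mulr_ge0// andbT.
  rewrite (@le_trans _ _ (t * (f 1 - f x) + (1 - t) * (f 1 - f y)))//.
    by move: cf; lra.
  by rewrite lerD// ler_wpM2l.
(* On the unit interval [k <= k 0]; finiteness allows [f 1 - k] to be integrated term by term. *)
have Ukoo : ('E_P[k \o U] < +oo)%E.
  suff : ('E_P[k \o U] <= 'E_P[cst (k 0%R)])%E.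
    by move=> /le_lt_trans; apply; rewrite expectation_cst ltry.
  apply: expectation_le => //; first exact: measurableT_comp.
  - by move=> w; exact: k0.
  - by move=> w; exact: k0.
  by apply: filterS (uniform_ae unifU) => w /andP[U0 _] /=; exact: nik.
have XUk := XU k k0 nik ck.
have Xkoo := le_lt_trans XUk Ukoo.
have mkX (Z : {RV P >-> R}) : measurable_fun [set: Omega] (fun w => f 1 - k (Z w)).
  by apply: measurable_funB => //; exact: measurableT_comp.
(* The chain is [E f(U) = f 1 - E k(U) <= f 1 - E k(X) <= E f(X)]. *)
rewrite (@expectation_ae_eq _ (fun w => f 1 - k (U w)))//; last 2 first.
- exact: measurableT_comp.
- apply: filterS (uniform_ae unifU) => w /andP[_ U1] /=.
  by rewrite /k max_l ?subKr// subr_ge0 ndf.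
apply: (@le_trans _ _ 'E_P[fun w => (f 1 - k (X w))%R]%E); last first.
  apply: expectation_mono => //; first exact: measurableT_comp.
  by move=> w; rewrite lerBlDl -lerBlDr /k le_max lexx.
have cE (Z : {RV P >-> R}) : ('E_P[k \o Z] < +oo)%E ->
    ('E_P[fun w => (f 1 - k (Z w))%R] = (f 1)%:E - 'E_P[k \o Z])%E.
  by apply: expectation_cstB => [|w]; [exact: measurableT_comp|exact: k0].
by rewrite !cE// leeB.
Qed.

(** Jensen is applied pointwise; what remains is linearity of expectation, valid under any
    dependence between the [X i]. *)
Lemma pstar_variable_convex : rich P ->
  closed_convex_combinations (@pstar_variable _ _ _ P).
Proof.
move=> /rich_uniform[U unifU] K lambda X pX l0 l1.
apply/(pstar_variableP _ unifU) => k k0 nik ck.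
have mk : measurable_fun [set: R] k by exact: nonincreasing_measurable.
have mkX i : measurable_fun [set: Omega] (fun w => (k (X i w))%:E).
  by apply/measurable_EFinP; exact: measurableT_comp.
rewrite expectation.unlock.
apply: (@le_trans _ _ (\int[P]_w \sum_(i < K) ((lambda i)%:E * (k (X i w))%:E))%E).
  apply: ge0_le_integral => //.
  - by move=> w _; rewrite lee_fin /= k0.
  - by apply/measurable_EFinP; exact: measurableT_comp.
  - by apply: emeasurable_sum => i; exact: measurable_funeM.
  - move=> w _ /=; rewrite mfun_sum sumEFin lee_fin.
    rewrite (eq_bigr (fun i => lambda i * X i w))//; exact: convex_sum_le.
rewrite ge0_integral_sum//; last 2 first.
- by move=> i; exact: measurable_funeM.
- by move=> i w _; rewrite -EFinM lee_fin mulr_ge0.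
apply: (@le_trans _ _ (\sum_(i < K) (lambda i)%:E * 'E_P[k \o U])%E).
  apply: lee_sum => i _; rewrite ge0_integralZl//.
  - rewrite lee_wpmul2l ?lee_fin//.
    by have /(pstar_variableP _ unifU)/(_ k k0 nik ck) := pX i; rewrite expectation.unlock.
  - by move=> w _; rewrite lee_fin.
  - by rewrite lee_fin.
rewrite -ge0_sume_distrl// ?sumEFin ?l1 ?mul1e ?expectation.unlock// => i _.
by rewrite lee_fin.
Qed.

End PstarVariables.

(** * Mixtures and limits in distribution of p*-variables *)

Section PstarClosure.
Context {d : measure_display} {Omega : measurableType d} {R : realType}.
Variable P : probability Omega R.
Implicit Types X Y T U : {RV P >-> R}.

(** Viewed as a kernel from the one-point space, [mu] composes with [F] to give [nu], and
    integration against a composition of kernels is iterated integration. *)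
Lemma ge0_integral_mixture d' (Theta : measurableType d')
    (mu : probability Theta R) (F : R.-pker Theta ~> R)
    (nu : {measure set R -> \bar R}) (f : R -> \bar R) :
  (forall A, measurable A -> nu A = \int[mu]_t F t A)%E ->
  measurable_fun [set: R] f -> (forall x, 0 <= f x)%E ->
  (\int[nu]_x f x = \int[mu]_t \int[F t]_x f x)%E.
Proof.
move=> nuF mf f0.
pose l : R.-sfker unit ~> Theta :=
  kprobability (@measurable_cst _ _ unit _ setT (mu : pprobability Theta R)).
pose k := @kernel.kernel_snd _ _ _ unit _ _ R F.
rewrite -(@integral_kcomp _ _ _ _ _ _ _ l k tt f)//.
by apply: eq_measure_integral => A mA _; rewrite nuF.
Qed.

Lemma pstar_variable_mixture : rich P ->
  closed_distribution_mixtures (@pstar_variable _ _ _ P).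
Proof.
move=> /rich_uniform[U unifU] d' Theta mu F SF X XF.
apply/(pstar_variableP _ unifU) => k k0 nik ck.
have mk : measurable_fun [set: R] (EFin \o k).
  by apply/measurable_EFinP; exact: nonincreasing_measurable.
have distrE (Z : {RV P >-> R}) :
    ('E_P[k \o Z] = \int[distribution P Z]_x (EFin \o k) x)%E.
  by rewrite ge0_integral_distribution// expectation.unlock.
rewrite distrE (ge0_integral_mixture XF)//.
rewrite -(mule1 'E_P[_])%E -(@probability_setT _ _ _ mu) -integral_cst//.
apply: ge0_le_integral => //.
- by move=> t _; apply: integral_ge0 => x _; rewrite lee_fin.
- apply: (@measurable_fun_integral_kernel _ _ _ _ _ F) => // A mA.
  exact: measurable_kernel.
- move=> t _; have [Y /(pstar_variableP _ unifU)/(_ k k0 nik ck) YU YF] := SF t.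
  have -> : (\int[F t]_x (EFin \o k) x = \int[distribution P Y]_x (EFin \o k) x)%E.
    apply: eq_measure_integral => A mA _; exact/esym/YF.
  by rewrite -distrE.
Qed.

Lemma limn_einf_le (u : (\bar R)^nat) c :
  (forall n, u n <= c)%E -> (limn_einf u <= c)%E.
Proof.
move=> uc; rewrite limn_einf_lim; apply: lime_le; first exact: is_cvg_einfs.
near=> n; apply: le_trans (uc n); apply: ereal_inf_lbound.
by exists n => //=.
Unshelve. all: by end_near. Qed.

Lemma limn_einf_ge (u v : (\bar R)^nat) l : v @ \oo --> l ->
  (forall n, v n <= u n)%E -> (l <= limn_einf u)%E.
Proof.
move=> vl vu; rewrite limn_einf_lim -(cvg_lim _ (cvg_einfs vl))//.
apply: lee_lim; [exact: is_cvg_einfs..|].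
near=> n; apply: le_ereal_inf_tmp => _ [m nm <-]; apply: le_trans (vu m).
by apply: ereal_inf_lbound; exists m.
Unshelve. all: by end_near. Qed.

(** Each tail [P(k(X) > r)] is at most the lower limit of the tails [P(k(X_n) > r)]; by the
    layer-cake formula and Fatou, [E k(X) <= liminf E k(X_n)]. *)
Lemma pstar_variable_cvg : rich P ->
  closed_cvg_in_distribution (@pstar_variable _ _ _ P).
Proof.
move=> /rich_uniform[U unifU] X_ X pX_ cvgX.
apply/(pstar_variableP _ unifU) => k k0 nik ck.
have mk : measurable_fun [set: R] k by exact: nonincreasing_measurable.
rewrite (layer_cake _ mk)//.
pose f n r := ccdf (rv_comp mk (X_ n)) r.
apply: (@le_trans _ _ (\int[lebesgue_measure]_(r in `[0%R, +oo[) limn_einf (f ^~ r)))%E.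
  apply: ge0_le_integral => //.
  - by apply: measurable_funTS; exact: ccdf_measurable.
  - apply: measurableT_comp => //; apply: measurable_fun_limn_esup => n.
    apply: measurableT_comp => //.
    by apply: measurable_funTS; exact: ccdf_measurable.
  - move=> r _; apply: (@measure_downset_le _ _ _ P X (k @^-1` `]r, +oo[)) => //.
    + move=> x y xy; rewrite /= !in_itv/= !andbT => /lt_le_trans; apply; exact: nik.
    + by apply: (@limn_einf_ge _ (fun=> 0%E)); [exact: cvg_cst|].
    + move=> x; rewrite /= in_itv/= andbT => rx.
      (* The set [{k > r}] extends beyond [x], which leaves room in it for a continuity point [z] of
         [df X]; then [X_n <= z] forces [k(X_n) > r]. *)
      have [y xy ry] := convex_lt_right ck nik rx.
      have [z /andP[xz zy] contz] := df_continuity_dense X xy.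
      apply: (@le_trans _ _ (cdf X z)); first exact/cdf_nondecreasing/ltW.
      apply: (@limn_einf_ge _ (fun n => cdf (X_ n) z)).
        rewrite cdf_df; under eq_fun do rewrite cdf_df.
        by apply: cvg_EFin; [exact: nearW|exact: cvgX].
      move=> n; apply: (@preimage_measure_le _ _ _ P (X_ n) (rv_comp mk (X_ n))) => // w.
      rewrite /= !in_itv/= andbT => Xz.
      by rewrite (lt_le_trans ry)// nik// (le_trans Xz)// ltW.
apply: le_trans (fatou _ _ _ _) _ => //.
- by move=> n; apply: measurable_funTS; exact: ccdf_measurable.
apply: limn_einf_le => n; rewrite -(layer_cake _ mk)//.
by have /(pstar_variableP _ unifU) := pX_ n; apply.
Qed.

End PstarClosure.

(** * Mid p-variables described by families of intervals *)

Section Mid.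
Context {d : measure_display} {Omega : measurableType d} {R : realType}.
Variable P : probability Omega R.
Implicit Types X Y T U : {RV P >-> R}.
Implicit Types (u v x a : R) (l r : R -> R).

(** Compactness of [[a, b]] gives a cluster point of the image, and an ultrafilter converges to its
    cluster points. *)
Lemma ultrafilter_cvg (G : set_system nat) (s : nat -> R) (a b : R) :
  UltraFilter G -> (forall n, a <= s n <= b) -> exists x : R, s @ G --> x.
Proof.
move=> UG sab.
have PG : ProperFilter (s @ G) by exact: fmap_proper_filter.
have Gab : (s @ G) `[a, b]%classic.
  by apply: (@filterS _ G _ setT) => [n _|]; [rewrite /= in_itv/= sab|exact: filterT].
have [x [_ clx]] := segment_compact PG Gab.
exists x => A Ax; have [//|GA] := in_ultra_setVsetC (s @^-1` A) UG.
by have [y [nAy Ay]] := clx (~` A) A GA Ax.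
Qed.

Lemma df_left_cvg T x : cvg (df T s @[s --> x^'-]).
Proof.
apply: (@nondecreasing_at_left_is_cvgr _ (df T) x).
  by near=> z; move=> u v _ _; exact: df_nondecreasing.
by near=> z; exists 1 => _ [u _ <-]; exact: df_le1.
Unshelve. all: by end_near. Qed.

Lemma le_df_left T x a : a < x -> df T a <= df_left T x.
Proof.
move=> ax; apply: limr_ge; first exact: df_left_cvg.
by near=> s; apply/df_nondecreasing/ltW; near: s; exact: nbhs_left_gt.
Unshelve. all: by end_near. Qed.

Lemma df_left_le T x (c : R) : (forall a, a < x -> df T a <= c) -> df_left T x <= c.
Proof.
move=> dfc; apply: limr_le; first exact: df_left_cvg.
by near=> s; apply: dfc; near: s; exact: nbhs_left_lt.
Unshelve. all: by end_near. Qed.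

(** By conversion, [mid_transform T] is [mid_df T] composed with [T]. *)
Definition mid_df T x : R := 2^-1 * df_left T x + 2^-1 * df T x.

Lemma mid_df_nondecreasing T : nondecreasing_fun (mid_df T).
Proof.
move=> x y xy; rewrite lerD// ler_wpM2l//; last exact: df_nondecreasing.
apply: df_left_le => a ax; apply: le_df_left; exact: lt_le_trans xy.
Qed.

Lemma measurable_mid_df T : measurable_fun [set: R] (mid_df T).
Proof. by apply: nondecreasing_measurable => //; exact: mid_df_nondecreasing. Qed.

(** Used for [0 < u < 1], where the set is nonempty and bounded below. *)
Definition quantile T u : R := inf [set x | u <= df T x].

Lemma quantile_has_inf T u : 0 < u < 1 -> has_inf [set x | u <= df T x].
Proof.
move=> /andP[u0 u1]; split.
  have /fine_cvgP[_ cvT] := @cvg_cdfy1 _ _ _ P T.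
  have /filter_ex[x ux] : \forall t \near +oo, u < df T t by apply: cvgr_gt cvT _ u1.
  by exists x; exact: ltW.
have /fine_cvgP[_ cvT] := @cvg_cdfNy0 _ _ _ P T.
have /filter_ex[x xu] : \forall t \near -oo, df T t < u by apply: cvgr_lt cvT _ u0.
exists x => y /= uy.
rewrite leNgt; apply/negP => /ltW/(df_nondecreasing T)/(le_trans uy).
by rewrite leNgt xu.
Qed.

(** The infimum is attained, by right continuity. *)
Lemma df_quantile_ge T u : 0 < u < 1 -> u <= df T (quantile T u).
Proof.
move=> /(quantile_has_inf T) infT.
have cvT : df T s @[s --> (quantile T u)^'+] --> df T (quantile T u).
  exact: df_right_continuous.
rewrite -(cvg_lim _ cvT)//; apply: limr_ge; first by apply/cvg_ex; eexists; exact: cvT.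
near=> s.
have sq : 0 < s - quantile T u by rewrite subr_gt0; near: s; exact: nbhs_right_gt.
have [x /= ux xs] := inf_adherent sq infT.
rewrite (le_trans ux)// df_nondecreasing// ltW// (lt_le_trans xs)//.
by rewrite -/(quantile T u) addrC subrK.
Unshelve. all: by end_near. Qed.

Lemma quantile_le T u x : 0 < u < 1 -> u <= df T x -> quantile T u <= x.
Proof. by move=> /(quantile_has_inf T)[_ ?] ux; apply: ge_inf. Qed.

Lemma lt_quantile T u x : 0 < u < 1 -> x < quantile T u -> df T x < u.
Proof.
by move=> u01 xq; rewrite ltNge; apply/negP => /(quantile_le u01); rewrite leNgt xq.
Qed.

(* ]l u, r u[ is the interval containing u; l u = r u = u if there is none. *)
Definition midpoint_partition l r := forall u, 0 < u < 1 ->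
  [/\ 0 <= l u, l u <= u, u <= r u, r u <= 1 &
      forall v, l u < v < r u -> l v = l u /\ r v = r u].

(* The midpoint map is at most the quantile function of X. *)
Definition midpoint_dominated X l r :=
  forall u a, 0 < u < 1 -> a < (l u + r u) / 2 -> df X a <= u.

(** The interval of [u] is the jump of [df T] at the quantile of [u], and its midpoint is the value
    of [mid_df T] there. *)
Lemma mid_p_variable_partition X : mid_p_variable X ->
  exists l r, midpoint_partition l r /\ midpoint_dominated X l r.
Proof.
case=> T; pose M : {RV P >-> R} := rv_comp (measurable_mid_df T) T.
rewrite -[mid_transform T]/(M : Omega -> R) => /order1P XM.
exists (fun u => df_left T (quantile T u)), (fun u => df T (quantile T u)).
split=> [u u01|u a u01 aq].
  have lu : df_left T (quantile T u) <= u.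
    by apply: df_left_le => a aq; apply/ltW/lt_quantile.
  split; [|exact: lu|exact: df_quantile_ge|exact: df_le1|].
    by rewrite (le_trans (df_ge0 T (quantile T u - 1)))// le_df_left// gtrBl.
  move=> v /andP[lv vr].
  have v01 : 0 < v < 1.
    rewrite (lt_le_trans vr (df_le1 _ _)) andbT (le_lt_trans _ lv)//.
    by rewrite (le_trans (df_ge0 T (quantile T u - 1)))// le_df_left// gtrBl.
  suff -> : quantile T v = quantile T u by [].
  (* Were the quantile of [v] smaller than that of [u], [df T] at it would be at most the left limit
     at the quantile of [u], which is below [v]. *)
  apply/le_anti; rewrite quantile_le ?(ltW vr)//= leNgt; apply/negP => qvu.
  have := le_lt_trans (le_df_left T qvu) lv.
  by rewrite ltNge df_quantile_ge.
(* From the quantile of [u] on, [mid_df T] exceeds [a]; so [mid_df T (T w) <= a] forces [T w]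
   strictly below this quantile, where [df T] is less than [u]. *)
rewrite (le_trans (XM a))// -lee_fin -cdf_df.
apply: (@measure_downset_le _ _ _ P T (mid_df T @^-1` `]-oo, a])).
- move=> x y xy; rewrite /= !in_itv/=; apply: le_trans; exact: mid_df_nondecreasing.
- by rewrite lee_fin; case/andP: u01 => /ltW.
move=> x; rewrite /= in_itv/= => xa; rewrite cdf_df lee_fin.
apply/ltW/lt_quantile => //; rewrite ltNge; apply/negP => qx.
have := le_trans (mid_df_nondecreasing T qx) xa; apply/negP; rewrite -ltNge.
by apply: lt_le_trans aq _; rewrite /mid_df; lra.
Qed.

(** If two ends were in the wrong order, one of the points would lie strictly inside the interval of
    the other, and the ends would agree. *)
Lemma midpoint_partition_mono l r u v : midpoint_partition l r ->
  0 < u < 1 -> 0 < v < 1 -> u <= v -> l u <= l v /\ r u <= r v.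
Proof.
move=> part u01 v01; rewrite le_eqVlt => /predU1P[->//|uv].
have [_ lu ur _ pu] := part u u01; have [_ lv vr _ pv] := part v v01.
split; rewrite leNgt; apply/negP => lt.
  have [] : l u = l v /\ r u = r v by apply: pv; lra.
  by lra.
have [] : l v = l u /\ r v = r u by apply: pu; lra.
by lra.
Qed.

(** The values 0 and 1 outside the unit interval keep the map nondecreasing on the whole line, hence
    measurable. *)
Definition midpoint l r u : R :=
  if u <= 0 then 0 else if 1 <= u then 1 else (l u + r u) / 2.

Lemma midpointE l r u : 0 < u < 1 -> midpoint l r u = (l u + r u) / 2.
Proof. by move=> /andP[u0 u1]; rewrite /midpoint leNgt u0/= leNgt u1. Qed.

Lemma midpoint_nondecreasing l r :
  midpoint_partition l r -> nondecreasing_fun (midpoint l r).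
Proof.
move=> part.
have in01 u : 0 <= midpoint l r u <= 1.
  rewrite /midpoint; case: ifPn => u0; first by lra.
  case: ifPn => u1; first by lra.
  by have [|] := part u; lra.
move=> u v uv; have [u0|u0] := leP u 0.
  by rewrite {1}/midpoint u0; case/andP: (in01 v).
have [v1|v1] := leP 1 v.
  by rewrite {2}/midpoint v1 (lt_geF (lt_le_trans u0 uv)); case/andP: (in01 u).
have u01 : 0 < u < 1 by lra.
have v01 : 0 < v < 1 by lra.
have [luv ruv] := midpoint_partition_mono part u01 v01 uv.
by rewrite !midpointE//; lra.
Qed.

(** The witness [T] is the midpoint map applied to [U]; its mid p-value is almost surely at most [T]
    itself. *)
Lemma partition_mid_p_variable (U : {RV P >-> R}) X l r : uniform01 U ->
  midpoint_partition l r -> midpoint_dominated X l r -> mid_p_variable X.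
Proof.
move=> unifU part dom.
have mphi : measurable_fun [set: R] (midpoint l r).
  by apply: nondecreasing_measurable => //; exact: midpoint_nondecreasing.
have ndphi := midpoint_nondecreasing part.
pose T := rv_comp mphi U; exists T.
have midT u : 0 < u < 1 -> mid_df T (midpoint l r u) <= midpoint l r u.
  move=> u01; have [l0 lu ur r1 pu] := part u u01.
  (* A level above [r u] has a strictly larger midpoint. *)
  have dfT : df T (midpoint l r u) <= r u.
    rewrite -[leRHS](df_uniform unifU); last by lra.
    rewrite -lee_fin -!cdf_df; apply: (@preimage_measure_le _ _ _ P T U) => // w.
    rewrite /= !in_itv/= !leNgt; apply: contra => ruv; set v := U w in ruv *.
    have [v1|v1] := leP 1 v.
      by rewrite midpointE// /midpoint v1 lt_geF; lra.
    have v01 : 0 < v < 1 by lra.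
    have [|luv _] := midpoint_partition_mono part u01 v01; first by lra.
    have [_ _ vr _ _] := part v v01.
    by rewrite !midpointE//; lra.
  (* A level above [l u] is at least [u] or shares its interval, so its midpoint is no smaller. *)
  have dflT : df_left T (midpoint l r u) <= l u.
    apply: df_left_le => a au; rewrite -[leRHS](df_uniform unifU); last by lra.
    rewrite -lee_fin -!cdf_df; apply: (@preimage_measure_le _ _ _ P T U) => // w.
    rewrite /= !in_itv/= !leNgt; apply: contra => luv; set v := U w in luv *.
    apply: (lt_le_trans au); have [uv|vu] := leP u v; first exact: ndphi.
    have v01 : 0 < v < 1 by lra.
    by have [|lE rE] := pu v; [lra|rewrite !midpointE// lE rE].
  by rewrite /mid_df {3}midpointE//; lra.
pose M : {RV P >-> R} := rv_comp (measurable_mid_df T) T.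
rewrite -[mid_transform T]/(M : Omega -> R); apply/order1P => a.
(* The slack [e] turns [U <= df X a - e] into [U < df X a], which domination, by contraposition,
   converts into a midpoint at most [a]. *)
apply/ler_addgt0Pr => e e0; rewrite -lerBlDr.
have h1 := df_le1 X a.
apply: (@le_trans _ _ (df U (df X a - e))).
  rewrite (df_uniformE _ unifU) le_max le_min lexx/=; lra.
rewrite -lee_fin -!cdf_df.
(* The partition says nothing about levels [U <= 0], which form a null event. *)
have U0 : P (U @^-1` `]-oo, 0]) = 0%E.
  by rewrite -[LHS]/(cdf U 0) cdf_df df_uniform_le0.
rewrite -[leRHS]adde0 -U0.
have mP (Z : {RV P >-> R}) b : measurable (Z @^-1` `]-oo, b]).
  exact: measurable_funPTI.
apply: le_trans (measureU2 P (mP M a) (mP U 0)).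
apply: (@le_measure _ _ _ P); rewrite ?inE//; first exact: measurableU.
move=> w; rewrite /= !in_itv/= => Uw; have [w0|w0] := leP (U w) 0; [by right|left].
have u01 : 0 < U w < 1 by lra.
apply: le_trans (midT _ u01) _; rewrite leNgt midpointE//; apply/negP => au.
by have := dom _ _ u01 au; lra.
Qed.

End Mid.

(** * Mid p-variables: limits in distribution, failure of convexity *)

Section MidClosure.
Context {d : measure_display} {Omega : measurableType d} {R : realType}.
Variable P : probability Omega R.
Implicit Types X Y T U : {RV P >-> R}.
Implicit Types (u v x a : R) (l r : R -> R).

Lemma midpoint_partition_ultralimit (G : set_system nat) (l r : nat -> R -> R) :
  UltraFilter G -> (forall n, midpoint_partition (l n) (r n)) ->
  exists l' r', midpoint_partition l' r' /\ forall u, 0 < u < 1 ->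
    l ^~ u @ G --> l' u /\ r ^~ u @ G --> r' u.
Proof.
move=> UG part.
have lim_ex (s : nat -> R -> R) : (forall n u, 0 < u < 1 -> 0 <= s n u <= 1) ->
    exists s' : R -> R, forall u : R, 0 < u < 1 -> s ^~ u @ G --> s' u.
  move=> s01; suff /choice[s' ss'] : forall u : R, exists x : R,
      0 < u < 1 -> s ^~ u @ G --> x by exists s'.
  move=> u.
  have [u01|nu01] := pselect (0 < u < 1); last by exists 0.
  by have [|x sx] := @ultrafilter_cvg R G (s ^~ u) 0 1; [move=> n; exact: s01|exists x].
have [|l' ll] := lim_ex l; first by move=> n u u01; have [] := part n u u01; lra.
have [|r' rr] := lim_ex r; first by move=> n u u01; have [] := part n u u01; lra.
exists l', r'; split=> [u u01|u u01]; last by split; [exact: ll|exact: rr].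
split.
- by apply: (cvgr_to_ge (ll u u01)); apply: filterE => n; have [] := part n u u01.
- by apply: (cvgr_to_le (ll u u01)); apply: filterE => n; have [] := part n u u01.
- by apply: (cvgr_to_ge (rr u u01)); apply: filterE => n; have [] := part n u u01.
- by apply: (cvgr_to_le (rr u u01)); apply: filterE => n; have [] := part n u u01.
- move=> v /andP[lv vr].
  have [l0 r1] : 0 <= l' u /\ r' u <= 1.
    split.
      by apply: (cvgr_to_ge (ll u u01)); apply: filterE => n; have [] := part n u u01.
    by apply: (cvgr_to_le (rr u u01)); apply: filterE => n; have [] := part n u u01.
  have v01 : 0 < v < 1 by lra.
  (* Being strictly between the limits is an open condition, so [v] lies inside the [n]-th interval
     of [u] along [G]; the ends at [u] and [v] then agree and have equal limits. *)
  have lrE : \forall n \near G, l n v = l n u /\ r n v = r n u.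
    have Gl : \forall n \near G, l n u < v by apply: cvgr_lt (ll u u01) _ lv.
    have Gr : \forall n \near G, v < r n u by apply: cvgr_gt (rr u u01) _ vr.
    near=> n; have [_ _ _ _] := part n u u01; apply.
    by apply/andP; split; near: n.
  split.
  + rewrite -(cvg_lim _ (ll v v01))//; apply: cvg_lim => //.
    apply: cvg_trans (ll u u01); apply: near_eq_cvg.
    by apply: filterS lrE => n [].
  + rewrite -(cvg_lim _ (rr v v01))//; apply: cvg_lim => //.
    apply: cvg_trans (rr u u01); apply: near_eq_cvg.
    by apply: filterS lrE => n [].
Unshelve. all: by end_near. Qed.

Lemma mid_p_variable_cvg : rich P ->
  closed_cvg_in_distribution (@mid_p_variable _ _ _ P).
Proof.
move=> /rich_uniform[U unifU] X_ X mX_ cvgX.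
have [l /choice[r lr]] := choice (fun n => mid_p_variable_partition (mX_ n)).
have [G [UG sG]] := @ultraFilterLemma nat \oo _.
have [l' [r' [part' lim']]] := midpoint_partition_ultralimit UG (fun n => (lr n).1).
apply: (partition_mid_p_variable unifU part') => u a u01 au.
have [ll rr] := lim' u u01.
(* As [x] is strictly below the limiting midpoint, it is below the [n]-th one along [G], where
   domination gives [df (X_ n) x <= u]. *)
have [x /andP[ax xu] contx] := df_continuity_dense X au.
rewrite (le_trans (df_nondecreasing X (ltW ax)))//.
have cvx : df (X_ n) x @[n --> G] --> df X x.
  by apply: cvg_trans (cvgX x contx) => A /sG.
apply: (cvgr_to_le cvx).
have cvm : (l n u + r n u) / 2 @[n --> G] --> (l' u + r' u) / 2.
  by apply: cvgMl; exact: cvgD.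
have ev : \forall n \near G, x < (l n u + r n u) / 2 by apply: cvgr_gt cvm _ xu.
by apply: filterS ev => n; exact: (lr n).2.
Qed.

(* [l u2 <= 2 * q2 - u2 < u1] puts u1 and u2 in the same interval, whose
   midpoint is at least [u2 / 2]. *)
Lemma not_mid_p_variable X u1 u2 q1 q2 : 0 < u1 -> u1 < u2 -> u2 < 1 ->
  u1 < df X q1 -> u2 < df X q2 -> 2 * q2 < u1 + u2 -> 2 * q1 < u2 ->
  ~ mid_p_variable X.
Proof.
move=> u10 u12 u21 h1 h2 q2u q1u /mid_p_variable_partition[l [r [part dom]]].
have u101 : 0 < u1 < 1 by lra.
have u201 : 0 < u2 < 1 by lra.
have midle u q : 0 < u < 1 -> u < df X q -> (l u + r u) / 2 <= q.
  by move=> u01 uq; rewrite leNgt; apply/negP => /(dom _ _ u01); rewrite leNgt uq.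
have := midle _ _ u101 h1; have := midle _ _ u201 h2.
have [l20 _ u2r _ p2] := part u2 u201.
move=> m2; have [|-> ->] := p2 u1; first by lra.
lra.
Qed.

(* The mid p-value of a variable taking two values, the smaller one with
   probability b. *)
Definition two_point U b : Omega -> R :=
  fun w => if U w <= b then b / 2 else (1 + b) / 2.

Lemma measurable_two_point U b : measurable_fun [set: Omega] (two_point U b).
Proof.
apply: measurable_fun_if => //.
apply: measurable_fun_ler => //.
Qed.

Definition two_pointRV U b : {RV P >-> R} := rv P (measurable_two_point U b).

(** The intervals are []0, b[] and []b, 1[]. The level [b] goes with the upper one: a value below
    [(1 + b) / 2] occurs only if [U <= b]. *)
Lemma two_point_mid_p_variable U b : uniform01 U -> 0 <= b <= 1 ->
  mid_p_variable (two_pointRV U b).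
Proof.
move=> unifU b01.
apply: (@partition_mid_p_variable _ _ _ P U _ (fun u => if u < b then 0 else b)
  (fun u => if u < b then b else 1)) => //.
  move=> u u01; case: ifPn => ub; split; try lra.
    by move=> v /andP[v0 vb]; rewrite vb.
  by move=> v /andP[bv v1]; rewrite ltNge (ltW bv).
move=> u a u01; case: ifPn => ub au.
  apply: (@le_trans _ _ 0); last by lra.
  rewrite -lee_fin -cdf_df; suff -> : cdf (two_pointRV U b) a = 0%E by [].
  rewrite /cdf /distribution/= /pushforward (_ : _ @^-1` _ = set0) ?measure0//.
  apply/seteqP; split=> // w; rewrite /= in_itv/= /two_point.
  by case: ifP => _; lra.
apply: (@le_trans _ _ (df U b)); last by rewrite (df_uniform unifU)//; lra.
rewrite -lee_fin -!cdf_df.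
apply: (@preimage_measure_le _ _ _ P (two_pointRV U b) U) => // w.
by rewrite /= !in_itv/= /two_point; case: ifP => // _; lra.
Qed.

(** Almost surely, the first variable is 1/2 and the second takes the values 3/8 and 7/8, so their
    average is 7/16 where [U <= 3/4] and 11/16 elsewhere. *)
Lemma mid_p_variable_not_convex : rich P ->
  ~ closed_convex_combinations (@mid_p_variable _ _ _ P).
Proof.
move=> /rich_uniform[U unifU] closed.
pose X (i : 'I_2) := if i == 0 then two_pointRV U 1 else two_pointRV U (3 / 4).
have mX i : mid_p_variable (X i).
  by rewrite /X; case: ifP => _; apply: two_point_mid_p_variable => //; lra.
have h1 : \sum_(i < 2) 2^-1 = 1 :> R by rewrite big_ord_recl big_ord1; lra.
have h0 (i : 'I_2) : 0 <= 2^-1 :> R by rewrite invr_ge0 ler0n.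
have := @closed 2%N (fun=> 2^-1) X mX h0 h1; clear h0.
set Y := (\sum_(k < 2) _ : {mfun Omega >-> R}).
have YE w : Y w = 2^-1 * two_point U 1 w + 2^-1 * two_point U (3 / 4) w.
  by rewrite /Y mfun_sum !big_ord_recl big_ord0 /= addr0.
have YU q s : (forall w, U w <= s -> Y w <= q) -> df U s <= @df _ _ _ P Y q.
  move=> sq; rewrite -lee_fin -!cdf_df.
  have UY : U @^-1` `]-oo, s] `<=` Y @^-1` `]-oo, q].
    by move=> w; rewrite /= !in_itv/=; exact: sq.
  exact: (@preimage_measure_le _ _ _ P U Y).
(* The levels 5/8 and 15/16 are below 3/4 and 1, the values of [df Y] at 7/16 and 11/16. *)
apply: (@not_mid_p_variable _ (5 / 8) (15 / 16) (7 / 16) (11 / 16)); try lra.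
- apply: (@lt_le_trans _ _ (df U (3 / 4))); first by rewrite (df_uniform unifU); lra.
  by apply: YU => w Uw; rewrite YE /two_point Uw ifT; lra.
- apply: (@lt_le_trans _ _ (df U 1)); first by rewrite (df_uniform unifU); lra.
  by apply: YU => w Uw; rewrite YE /two_point Uw; case: ifP; lra.
Qed.

End MidClosure.

(** * Failure of mid p-variables under mixtures *)

Section MidMixture.
Context {d : measure_display} {Omega : measurableType d} {R : realType}.
Variable P : probability Omega R.
Implicit Types X Y T U : {RV P >-> R}.
Implicit Types (u v x a : R) (l r : R -> R).

(** Laws written as combinations of point masses reduce the mixture identity to arithmetic. *)
Lemma distribution_step3 U X (s t x y z : R) (A : set R) : uniform01 U ->
  0 <= s -> s <= t -> t <= 1 ->
  (forall w, U w <= s -> X w = x) ->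
  (forall w, s < U w <= t -> X w = y) ->
  (forall w, t < U w <= 1 -> X w = z) -> measurable A ->
  distribution P X A =
    (s%:E * \d_x A + (t - s)%:E * \d_y A + (1 - t)%:E * \d_z A)%E.
Proof.
move=> unifU s0 st t1 Xx Xy Xz mA; rewrite /distribution/= /pushforward.
have mXA : measurable (X @^-1` A) by exact: measurable_funPTI.
have mU (i : interval R) : measurable (U @^-1` [set` i]) by exact: measurable_funPTI.
have PU b : 0 <= b <= 1 -> P (U @^-1` `]-oo, b]) = b%:E.
  by move=> b01; rewrite -[LHS]/(cdf U b) cdf_df (df_uniform unifU).
have splitP (B C : set Omega) : measurable B -> measurable C ->
    P B = (P (B `&` ~` C) + P (B `&` C))%E.
  by move=> mB mC; rewrite -setDE; exact: measureDI.
(* The value [z] is prescribed only where [U <= 1], an event of full probability. *)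
have full (B : set Omega) : measurable B -> P B = P (B `&` U @^-1` `]-oo, 1]).
  move=> mB; rewrite (splitP _ _ mB (mU `]-oo, 1])).
  rewrite [X in (X + _)%E](_ : _ = 0%E) ?add0e//.
  have null : P (~` (U @^-1` `]-oo, 1])) = 0%E.
    by rewrite probability_setC//; rewrite PU ?subee//; lra.
  apply/eqP; rewrite -measure_le0 -null; apply: (@le_measure _ _ _ P); rewrite ?inE.
  - by apply: measurableI => //; apply: measurableC; exact: mU.
  - by apply: measurableC; exact: mU.
  - exact: subIsetr.
have piece (E : set Omega) c : measurable E ->
    (forall w, E w -> U w <= 1 -> X w = c) ->
    P (X @^-1` A `&` E) = (P E * \d_c A)%E.
  move=> mE Xc; rewrite full ?[P E]full//; last exact: measurableI.
  rewrite diracE; have [cA|cA] := boolP (c \in A).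
    rewrite mule1 -setIA; congr (P _); apply/seteqP; split=> [w []//|w [Ew]].
    by rewrite /= in_itv/= => U1; split=> //=; rewrite Xc//; exact: set_mem.
  rewrite mule0 (_ : _ `&` _ = set0) ?measure0//.
  apply/seteqP; split=> // w [[/= + Ew]]; rewrite in_itv/= => + U1.
  by rewrite Xc// => /mem_set; rewrite (negbTE cA).
rewrite (splitP _ _ mXA (mU `]-oo, t])).
have -> : ~` (U @^-1` `]-oo, t]) = U @^-1` `]t, +oo[.
  apply/seteqP; split=> w; rewrite /= !in_itv/= andbT.
    by move/negP; rewrite -ltNge.
  by rewrite leNgt => ->.
rewrite (piece _ z); last 2 first.
- exact: mU.
- by move=> w; rewrite /= in_itv/= andbT => tU U1; rewrite Xz// tU.
have -> : P (U @^-1` `]t, +oo[) = (1 - t)%:E.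
  by rewrite -[LHS]/(ccdf U t) ccdf_1_cdf cdf_df (df_uniform unifU)//; lra.
rewrite addeC; congr (_ + _)%E.
have stE : U @^-1` `]-oo, t] `&` ~` (U @^-1` `]-oo, s]) = U @^-1` `]s, t].
  apply/seteqP; split=> w; rewrite /= !in_itv/=.
    by move=> [Ut /negP]; rewrite -ltNge => ->.
  by move=> /andP[sU Ut]; split=> //; apply/negP; rewrite -ltNge.
have sE : U @^-1` `]-oo, t] `&` U @^-1` `]-oo, s] = U @^-1` `]-oo, s].
  apply/seteqP; split=> w; rewrite /= !in_itv/=; first by case.
  by move=> Us; split=> //; exact: le_trans st.
rewrite (splitP _ _ (measurableI _ _ mXA (mU _)) (mU `]-oo, s])).
rewrite -!setIA stE sE.
rewrite (piece _ y); last 2 first.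
- exact: mU.
- by move=> w; rewrite /= in_itv/= => /Xy.
rewrite (piece _ x); last 2 first.
- exact: mU.
- by move=> w; rewrite /= in_itv/= => /Xx.
rewrite addeC (PU s); last by lra.
congr (_ + _ * _)%E.
have := splitP _ _ (mU `]-oo, t]) (mU `]-oo, s]).
rewrite stE sE !PU; [|lra..].
by move=> Et; rewrite EFinB Et addeK.
Qed.

Section Kernel.
Variables (U : {RV P >-> R}).

(** For uniform [U], [true] gives the point mass at 1/2, and [false] gives mass 3/4 at 3/8 and 1/4
    at 7/8. *)
Definition two_point_law (c : bool) : {measure set R -> \bar R} :=
  distribution P (two_pointRV U (if c then 1 else 3 / 4)).

Let measurable_two_point_law (A : set R) : measurable A ->
  measurable_fun [set: bool] (two_point_law ^~ A).
Proof. by move=> mA _ B mB. Qed.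

HB.instance Definition _ := isKernel.Build _ _ _ _ R two_point_law
  measurable_two_point_law.

Let two_point_law_setT c : two_point_law c [set: R] = 1%E.
Proof. exact: probability_setT. Qed.

HB.instance Definition _ := Kernel_isProbability.Build _ _ _ _ R
  two_point_law two_point_law_setT.

End Kernel.

(** A fair mixture of the two laws has masses 3/8, 1/2, 1/8 at 3/8, 1/2, 7/8; [f] realizes it as a
    step function of [U]. *)
Lemma mid_p_variable_not_mixture : rich P ->
  ~ closed_distribution_mixtures (@mid_p_variable _ _ _ P).
Proof.
move=> /rich_uniform[U unifU] closed.
pose f w : R := if U w <= 3 / 8 then 3 / 8 else if U w <= 7 / 8 then 1 / 2 else 7 / 8.
have mf : measurable_fun [set: Omega] f.
  apply: measurable_fun_if => //; first exact: measurable_fun_ler.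
  apply: measurable_funTS; apply: measurable_fun_if => //; exact: measurable_fun_ler.
pose X := rv P mf.
have XU q s : (forall w, U w <= s -> X w <= q) -> df U s <= @df _ _ _ P X q.
  move=> sq; rewrite -lee_fin -!cdf_df.
  have UX : U @^-1` `]-oo, s] `<=` X @^-1` `]-oo, q].
    by move=> w; rewrite /= !in_itv/=; exact: sq.
  exact: (@preimage_measure_le _ _ _ P U X).
(* The levels 5/16 and 13/16 are below 3/8 and 7/8, the values of [df X] at 3/8 and 1/2. *)
apply: (@not_mid_p_variable _ _ _ P X (5 / 16) (13 / 16) (3 / 8) (1 / 2)); try lra.
- apply: (@lt_le_trans _ _ (df U (3 / 8))); first by rewrite (df_uniform unifU); lra.
  by apply: XU => w Uw; rewrite /X/= /f Uw.
- apply: (@lt_le_trans _ _ (df U (7 / 8))); first by rewrite (df_uniform unifU); lra.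
  by apply: XU => w Uw; rewrite /X/= /f Uw; case: ifP; lra.
apply: (closed _ bool (bernoulli_prob 2^-1) (two_point_law U)) => [c|A mA].
  exists (two_pointRV U (if c then 1 else 3 / 4)) => //.
  by apply: two_point_mid_p_variable => //; case: c; lra.
rewrite integral_bernoulli_prob//; last by lra.
have b1 : 0 <= 3 / 8 :> R by lra.
have b2 : 3 / 8 <= 7 / 8 :> R by lra.
have b3 : 7 / 8 <= 1 :> R by lra.
have b4 : 0 <= 3 / 4 :> R by lra.
have b5 : 3 / 4 <= 1 :> R by lra.
rewrite (distribution_step3 (x := 3 / 8) (y := 1 / 2) (z := 7 / 8)
  unifU b1 b2 b3)//; last first.
- by move=> w Uw; rewrite /X/= /f !lt_geF//; lra.
- by move=> w /andP[sU Ut]; rewrite /X/= /f Ut lt_geF.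
- by move=> w; rewrite /X/= /f => ->.
rewrite -[RHS]/((2^-1)%:E * distribution P (two_pointRV U 1%R) A +
  (unstable.onem 2^-1)%:E * distribution P (two_pointRV U (3 / 4)%R) A)%E.
rewrite (distribution_step3 (x := 1 / 2) (y := 1 / 2) (z := 1 / 2)
  unifU b1 b2 b3)//; last first.
- by move=> w Uw; rewrite /= /two_point ifT; lra.
- by move=> w Uw; rewrite /= /two_point ifT; lra.
- by move=> w Uw; rewrite /= /two_point ifT; lra.
(* With equal cut points the middle piece is empty, so its value 0 is arbitrary. *)
rewrite (distribution_step3 (x := 3 / 8) (y := 0) (z := 7 / 8)
  unifU b4 (lexx _) b5)//; last first.
- move=> w; rewrite /= /two_point; case: ifP => //; lra.
- move=> w; rewrite /= /two_point; case: ifP => //; lra.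
- move=> w; rewrite /= /two_point => ->; lra.
rewrite !diracE -!(EFinM, EFinD); congr EFin; rewrite /unstable.onem; lra.
Qed.
End MidMixture.

Theorem proposition3p3 (d : measure_display) (Omega : measurableType d)
  (R : realType) (P : probability Omega R)
  (P_atomless : atomless P) (P_rich : rich P) :
  (closed_convex_combinations (@pstar_variable d Omega R P) /\
   closed_distribution_mixtures (@pstar_variable d Omega R P)) /\
  (closed_distribution_mixtures (@p_variable d Omega R P) /\
   ~ closed_convex_combinations (@p_variable d Omega R P)) /\
  (~ closed_convex_combinations (@mid_p_variable d Omega R P) /\
   ~ closed_distribution_mixtures (@mid_p_variable d Omega R P)) /\
  (closed_cvg_in_distribution (@pstar_variable d Omega R P) /\
   closed_cvg_in_distribution (@p_variable d Omega R P) /\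
   closed_cvg_in_distribution (@mid_p_variable d Omega R P)).
Proof.
split; [split|split; [split|split; [split|split; [|split]]]].
- exact: pstar_variable_convex.
- exact: pstar_variable_mixture.
- exact: p_variable_mixture.
- exact: p_variable_not_convex.
- exact: mid_p_variable_not_convex.
- exact: mid_p_variable_not_mixture.
- exact: pstar_variable_cvg.
- exact: p_variable_cvg.
- exact: mid_p_variable_cvg.
Qed.
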